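(* Let $n\ge2$, let $P$ be a positive regular polynomial $n$-tuple, let $m\in\mathbb N^n$, and let $\mathscr M_z$ be the multiplication $n$-tuple on $\mathscr H^2_m(\triangle^n_P)$. Then: (i) $\mathscr M_z$ is never doubly commuting; (ii) $\mathscr M_z$ is never finitely rationally cyclic.
   Context: $\mathbb N$ = positive integers, $\mathbb C_*=\mathbb C\setminus\{0\}$, $z\diamond w=(z_1w_1,\ldots,z_nw_n)$, and $\overline z$ is the entrywise conjugate. For $n\ge2$ let $\varphi(z)=\big(\frac{z_1}{z_2},\ldots,\frac{z_{n-1}}{z_n},z_n\big)$ for $z\in\mathbb C\times\mathbb C_*^{n-1}$. A polynomial $n$-tuple $P=(P_1,\ldots,P_n)$ in $\mathbb C[z_1,\ldots,z_n]$ is positive regular if for each $j$, $P_j$ has nonnegative coefficients and $P_j(z)=a_jz_j+\sum_{k=2}^{N_j}Q_{jk}(z)$ with $a_j>0$ and $Q_{jk}$ homogeneous of degree $k$. The $P$-triangle is $\triangle^n_P=\{z\in\mathbb C\times\mathbb C_*^{n-1}: P_j(\varphi(z)\diamond\overline{\varphi(z)})<1,\ j=1,\ldots,n\}$. For $m\in\mathbb N^n$, $\mathscr H^2_m(\triangle^n_P)$ is the reproducing kernel Hilbert space of holomorphic functions on $\triangle^n_P$ with kernel $$\mathscr K_{P,m}(z,w)=\prod_{j=2}^n\frac1{z_j\overline w_j}\prod_{j=1}^n\frac1{\big(1-P_j(\varphi(z)\diamond\overline{\varphi(w)})\big)^{m_j}}.$$ Each $z_j$ is a multiplier of this space; $\mathscr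 M_{z_j}$ is the bounded operator of multiplication by $z_j$, and $\mathscr M_z=(\mathscr M_{z_1},\ldots,\mathscr M_{z_n})$. A commuting $n$-tuple $T$ on $H$ is doubly commuting if $T_j^*T_k=T_kT_j^*$ for all $j\ne k$. It is finitely rationally cyclic if there is a finite set $F\subseteq H$ such that $H$ is the closed linear span of $\{r(T)h: r\text{ a rational function with poles off the Taylor spectrum }\sigma(T),\ h\in F\}$. *)

(* Defs.v *)
From HB Require Import structures.
From mathcomp Require Import all_boot all_order all_algebra.
From mathcomp Require Import sesquilinear.
From mathcomp Require Import -(notations) mpoly.
From mathcomp Require Import all_classical all_reals all_analysis.

Set Implicit Arguments.
Unset Strict Implicit.
Unset Printing Implicit Defensive.

Import Order.TTheory GRing.Theory Num.Theory.
Import numFieldNormedType.Exports.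

Local Open Scope classical_set_scope.
Local Open Scope ring_scope.

(* The scalars form an abstract [C : numClosedFieldType], to be instantiated by
   the complex numbers [R[i]] over [R : realType].
   Coordinates are numbered from 0, so that the coordinate z_j of the
   literature is [z 0 (j-1)].
   The notations of [mpoly] are not imported because they clash with those of
   [all_analysis]: [mpoly n C] is the type of polynomials in n variables. *)

Section Triangle.
Context {C : numClosedFieldType} {n : nat}.
Implicit Types (z w : 'rV[C]_n) (P : 'I_n -> mpoly n C).

Definition mp_eval (p : mpoly n C) z : C := meval (fun i => z 0 i) p.

(* In the order of [C], [0 <= c] and [0 < c] say that [c] is real and
   nonnegative, resp. positive. *)
Definition positive_regular P : Prop := forall j : 'I_n,
  (forall mu, 0 <= mcoeff mu (P j)) /\
  exists (a : C) (N : nat) (Q : nat -> mpoly n C),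
    [/\ 0 < a,
        (forall k, Q k \is ishomog1 k mdeg) &
        P j = a *: mpolyX C (mnm1 j) + \sum_(2 <= k < N.+1) Q k].

(* [insub j.+1] is [None] exactly when [j] is the last coordinate. *)
Definition phi z : 'rV[C]_n :=
  \row_(j < n) if insub j.+1 is Some k then z 0 j / z 0 k else z 0 j.

Definition diamond z w : 'rV[C]_n := \row_(j < n) (z 0 j * w 0 j).

Definition conjv z : 'rV[C]_n := map_mx Num.conj z.

Definition triangle P : set 'rV[C]_n :=
  [set z : 'rV[C]_n | (forall j : 'I_n, (0 < j)%N -> z 0 j != 0) /\
           (forall j, mp_eval (P j) (diamond (phi z) (conjv (phi z))) < 1)].

Definition triangle_kernel P (m : 'I_n -> nat) z w : C :=
  (\prod_(j < n | (0 < j)%N) (z 0 j * Num.conj (w 0 j))^-1) *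
  \prod_(j < n) (1 - mp_eval (P j) (diamond (phi z) (conjv (phi w)))) ^- m j.

End Triangle.

(* A Hilbert space is a complete normed space [H] with an inner product [dot]
   (linear in its first argument) inducing the norm; [ev] identifies [H] with
   a space of functions on [D].  The values of [ev f] off [D] are irrelevant. *)
Record is_rkhs {C : numClosedFieldType} {E : Type} (D : set E) (K : E -> E -> C)
    (H : completeNormedModType C) (dot : {dot H for Num.conj})
    (ev : H -> E -> C) : Prop := IsRKHS {
  rkhs_norm : forall f, `|f| ^+ 2 = dot f f;
  rkhs_linear : forall z, D z -> scalar (ev ^~ z);
  rkhs_inj : forall f, (forall z, D z -> ev f z = 0) -> f = 0;
  rkhs_reproducing : forall w, D w -> exists2 k : H,
    (forall z, D z -> ev k z = K z w) & (forall f, ev f w = dot f k) }.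

(* [differentiable] is Frechet differentiability over the base field [C]. *)
Definition holomorphic_on {C : numClosedFieldType} {n : nat} (D : set 'rV[C]_n)
    (f : 'rV[C]_n -> C) : Prop :=
  forall z, D z -> differentiable f z.

Definition is_triangle_space {C : numClosedFieldType} {n : nat}
    (P : 'I_n -> mpoly n C) (m : 'I_n -> nat)
    (H : completeNormedModType C) (dot : {dot H for Num.conj})
    (ev : H -> 'rV[C]_n -> C) : Prop :=
  is_rkhs (triangle P) (triangle_kernel P m) dot ev /\
  (forall f, holomorphic_on (triangle P) (ev f)).

Definition is_mult_tuple {C : numClosedFieldType} {n : nat} (D : set 'rV[C]_n)
    (H : completeNormedModType C) (ev : H -> 'rV[C]_n -> C)
    (M : 'I_n -> {linear H -> H}) : Prop :=
  forall j, continuous (M j) /\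
            (forall f z, D z -> ev (M j f) z = z 0 j * ev f z).

Section OperatorTuples.
Context {C : numClosedFieldType} {n : nat} {H : completeNormedModType C}.
Implicit Types (T : 'I_n -> H -> H).

Definition adjoint (dot : {dot H for Num.conj}) (A : H -> H) : H -> H :=
  xget (fun=> 0) [set B : H -> H | forall f g, dot (A f) g = dot f (B g)].

Definition doubly_commuting (dot : {dot H for Num.conj}) T : Prop :=
  (forall j k, T j \o T k = T k \o T j) /\
  (forall j k, j != k ->
    adjoint dot (T j) \o T k = T k \o adjoint dot (T j)).

(* The Koszul operator of [T] on the tensor product of [H] with the exterior
   algebra on generators e_0, ..., e_(n-1): the coefficient of [x] at [J] is
   that of the wedge product of the e_j, j in J, in increasing order, and
   [koszul T x] is the sum over i of (e_i wedge) tensor (T i), applied to x. *)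
Definition koszul T (x : {ffun {set 'I_n} -> H}) : {ffun {set 'I_n} -> H} :=
  [ffun J : {set 'I_n} => \sum_(i in J)
     (-1 : C) ^+ #|[set k in J | (k < i)%N]%SET| *: T i (x (J :\ i)%SET)].

Definition taylor_spectrum T : set 'rV[C]_n :=
  [set lam | let S i f := T i f - lam 0 i *: f in
             [set x | koszul S x = 0] <> range (koszul S)].

Definition poly_op T (p : mpoly n C) (f : H) : H :=
  \sum_(mu <- msupp p) mcoeff mu p *:
    (\big[comp/id]_(i < n) iter (mu i) (T i)) f.

Definition inv_op (A : H -> H) : H -> H :=
  xget (fun=> 0) [set B : H -> H | cancel A B /\ cancel B A].

(* r(T) for the rational function r = p / q; [inv_op] is a genuine inverse when
   [q] has no zero on the Taylor spectrum, by the spectral mapping theorem. *)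
Definition ratio_op T (p q : mpoly n C) : H -> H :=
  poly_op T p \o inv_op (poly_op T q).

Definition lin_span (A : set H) : set H :=
  [set v | exists (d : nat) (a : 'I_d -> C) (u : 'I_d -> H),
     (forall i, A (u i)) /\ v = \sum_(i < d) a i *: u i].

Definition finitely_rationally_cyclic T : Prop :=
  exists F : set H, finite_set F /\
    closure (lin_span [set v | exists p q h,
      [/\ forall lam, taylor_spectrum T lam -> mp_eval q lam != 0,
          F h & v = ratio_op T p q h]]) = setT.

End OperatorTuples.

(* Main.v *)
(* Write [u = phi z], so that [z_j = u_j ... u_n].  Modulo the factor
   [1 / (z_2 ... z_n)] the space has a kernel that is a positive power series in
   [u \diamond conj v] in which every monomial occurs, and [z_j] acts as a
   weighted shift.  No power series is needed: letting [s] tend to 0 in the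
   rescaled kernel functions at the points with [u_(n-1) = x] and all other
   [u_k = s] gives, since the Gram matrices converge, vectors
   [k_x = (1 / q(x u_(n-1))) / (z_2 ... z_n)], with [q] a polynomial, that are
   orthogonal to the range of every multiplication operator.
   - [q] has a root, so the [k_x] span an infinite-dimensional space.  Since
     [<r(M) h, k_x> = r(0) <h, k_x>], no finite set is rationally cyclic.
   - The limit [f0] of [k_x] and the derivative [f1] of [k_x] at [x = 0] satisfy
     [z_n f1 = c z_(n-1) f0] with [c <> 0].  As [f0] is in the kernel of the
     adjoint of [M_n], double commutation would give [M_(n-1) f0 = 0]. *)

Require Import Defs.
From HB Require Import structures.
From mathcomp Require Import all_boot all_order all_algebra.
From mathcomp Require Import sesquilinear.
From mathcomp Require Import complex.
From mathcomp Require Import -(notations) mpoly.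
From mathcomp Require Import all_classical all_reals all_analysis.
From mathcomp Require Import ring.

Set Implicit Arguments.
Unset Strict Implicit.
Unset Printing Implicit Defensive.

Import Order.TTheory GRing.Theory Num.Theory.
Import numFieldNormedType.Exports.

Local Open Scope classical_set_scope.
Local Open Scope ring_scope.

(** * Inner product spaces *)

(** In the order of [C], [0 < s] forces [s] to be real, so [0^'+] is the filter of positive reals
    tending to 0. *)
Lemma near_right0 {C : numFieldType} (e : C) : 0 < e ->
  \forall s \near 0^'+, 0 < s < e.
Proof.
move=> e0; apply/nbhs_ballP; exists e => //= s; rewrite -ball_normE /= sub0r.
by rewrite normrN => se s0; rewrite s0 -{1}(gtr0_norm s0).
Qed.

Lemma id_cvg_right0 {C : numFieldType} : (x : C) @[x --> 0^'+] --> 0.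
Proof.
apply/cvgrPdist_lt => e e0; apply: filterS (near_right0 e0) => s /andP[s0 se].
by rewrite sub0r normrN gtr0_norm.
Qed.

Lemma horner_cvg {C : numFieldType} {T : Type} {F : set_system T}
    {FF : Filter F} (p : {poly C}) (h : T -> C) (l : C) :
  h @ F --> l -> p.[h x] @[x --> F] --> p.[l].
Proof.
move=> hl; elim/poly_ind: p => [|p c IH].
  by under eq_fun do rewrite horner0; rewrite horner0; exact: cvg_cst.
under eq_fun do rewrite hornerMXaddC; rewrite hornerMXaddC.
by apply: cvgD; [apply: cvgM|exact: cvg_cst].
Qed.

Section InnerProduct.
Context {C : numClosedFieldType} {H : completeNormedModType C}.
Variable (dot : {dot H for Num.conj}).
Hypothesis dot_norm : forall f, `|f| ^+ 2 = dot f f.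

Lemma dotC f g : dot f g = (dot g f)^*.
Proof. by rewrite [LHS](@hermC _ false Num.conj) expr0 mul1r. Qed.

Lemma dotZl a f g : dot (a *: f) g = a * dot f g.
Proof. exact: linearZl_LR. Qed.

Lemma dotZr a f g : dot f (a *: g) = a^* * dot f g.
Proof. exact: linearZr_LR. Qed.

Lemma dotDl f g h : dot (f + g) h = dot f h + dot g h.
Proof. exact: linearDl. Qed.

Lemma dotDr f g h : dot f (g + h) = dot f g + dot f h.
Proof. exact: linearDr. Qed.

Lemma dotBl f g h : dot (f - g) h = dot f h - dot g h.
Proof. exact: linearBl. Qed.

Lemma dotBr f g h : dot f (g - h) = dot f g - dot f h.
Proof. exact: linearBr. Qed.

Lemma dot_sumr (I : Type) (s : seq I) (Q : pred I) (a : I -> C) (u : I -> H) f :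
  dot f (\sum_(i <- s | Q i) a i *: u i) =
    \sum_(i <- s | Q i) (a i)^* * dot f (u i).
Proof. by rewrite linear_sumr; apply: eq_bigr => i _; exact: dotZr. Qed.

Lemma dot_suml (I : Type) (s : seq I) (Q : pred I) (a : I -> C) (u : I -> H) f :
  dot (\sum_(i <- s | Q i) a i *: u i) f =
    \sum_(i <- s | Q i) a i * dot (u i) f.
Proof. by rewrite linear_sumlz; apply: eq_bigr => i _; exact: dotZl. Qed.

(** Cauchy-Schwarz, from the squared norm of [dot g g] times the component of [f] orthogonal to
    [g]. *)
Lemma dot_le_norm f g : `|dot f g| <= `|f| * `|g|.
Proof.
have [->|g0] := eqVneq g 0; first by rewrite linear0r !normr0 mulr0.
have gg0 : 0 < dot g g by rewrite dnorm_gt0.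
rewrite -(@ler_pXn2r _ 2) ?nnegrE ?mulr_ge0// exprMn !dot_norm.
have := dnorm_ge0 dot (dot g g *: f - dot f g *: g).
rewrite dotBl !dotBr !dotZl !dotZr (dotC g f) (geC0_conj (ltW gg0)) => h.
rewrite -(ler_pM2l gg0) -subr_ge0; congr (0 <= _): h.
rewrite normCK; ring.
Qed.

Lemma dotl_cvg {T : Type} {F : set_system T} {FF : Filter F} (h : T -> H) l k :
  h @ F --> l -> dot (h x) k @[x --> F] --> dot l k.
Proof.
move=> hl; apply/cvgrPdistC_lt => e e0.
have d0 : 0 < e / (`|k| + 1) by rewrite divr_gt0// ltr_wpDl.
move/cvgrPdistC_lt/(_ _ d0): hl; apply: filterS => x hx.
rewrite -dotBl; apply: le_lt_trans (dot_le_norm _ _) _.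
rewrite ltr_pdivlMr ?ltr_wpDl// in hx.
apply: le_lt_trans hx; rewrite ler_wpM2l// lerDl//.
Qed.

Lemma dotr_cvg {T : Type} {F : set_system T} {FF : Filter F} (h : T -> H) l k :
  h @ F --> l -> dot k (h x) @[x --> F] --> dot k l.
Proof.
move=> hl; apply/cvgrPdistC_lt => e e0.
move/(dotl_cvg (k := k))/cvgrPdistC_lt/(_ _ e0): hl.
apply: filterS => x; rewrite -dotBl dotC norm_conjC dotBr. by [].
Qed.

Lemma dot_eq0 (f : H) : (forall g, dot g f = 0) -> f = 0.
Proof. by move=> /(_ f) /eqP; rewrite dnorm_eq0 => /eqP. Qed.

Lemma dot_cauchy_cvg {T : Type} {F : set_system T} {FF : ProperFilter F}
    (h : T -> H) :
  (forall e, 0 < e -> exists2 A, F A & forall x y, A x -> A y ->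
     dot (h x - h y) (h x - h y) < e) ->
  exists l : H, h @ F --> l.
Proof.
move=> hC; suff /cvg_ex [l hl] : cvg (h @ F) by exists l.
apply: cauchy_cvg; apply: cauchy_exP => e e0.
have [A FA hA] := hC (e ^+ 2) (exprn_gt0 _ e0).
have [x Ax] := filter_ex FA.
exists (h x); rewrite /nbhs /fmap /=; apply: (@filterS _ _ _ A) FA => y Ay.
rewrite /= -ball_normE /=.
by have := hA x y Ax Ay; rewrite -dot_norm ltr_pXn2r ?nnegrE // ltW.
Qed.

(* The Gram matrix depends on [s * t] only, so all its entries tend to [l] and
   the mutual distances tend to 0. *)
Lemma gram_cvg (h : C -> H) (psi : C -> C) (l e : C) : 0 < e ->
  (forall s t, 0 < s <= e -> 0 < t <= e -> dot (h s) (h t) = psi (s * t)) ->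
  psi @ 0^'+ --> l -> exists f : H, h @ 0^'+ --> f.
Proof.
move=> e0 hpsi psi_l; apply: dot_cauchy_cvg => d d0.
(* The squared distance is a signed sum of four Gram entries, each within [d / 4] of [l]. *)
have d4 : 0 < d / 4 by rewrite divr_gt0.
move/cvgrPdist_lt/(_ _ d4)/nbhs_ballP: psi_l => [r /= r0 hr].
(* The bound by 1 puts the product of two such numbers below [r]. *)
exists [set s | [/\ 0 < s <= e, s < 1 & s < r]].
  apply: filterS (filterI (near_right0 e0)
    (filterI (near_right0 ltr01) (near_right0 r0))).
  by move=> s /= [/andP[s0 se] [/andP[_ s1] /andP[_ sr]]]; rewrite s0 (ltW se).
move=> s t [s0e s1 sr] [t0e t1 tr].
have key a b : 0 < a <= e -> a < 1 -> 0 < b <= e -> b < r ->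
    `|l - dot (h a) (h b)| < d / 4.
  move=> a0e a1 b0e br; rewrite hpsi//.
  move: a0e b0e => /andP[a0 _] /andP[b0 _].
  apply: hr; rewrite -?ball_normE /= ?sub0r ?normrN ?mulr_gt0//.
  rewrite gtr0_norm ?mulr_gt0//; apply: lt_trans br.
  by rewrite gtr_pMl.
have : dot (h s - h t) (h s - h t) \is Num.real by rewrite ger0_real.
have -> : dot (h s - h t) (h s - h t) =
    (l - dot (h s) (h t)) + (l - dot (h t) (h s)) - (l - dot (h s) (h s))
    - (l - dot (h t) (h t)) by rewrite dotBl !dotBr; ring.
move=> nr; apply: le_lt_trans (real_ler_norm nr) _.
have -> : d = d / 4 + d / 4 + d / 4 + d / 4 by field.
apply: le_lt_trans (ler_normB _ _) _; rewrite ltrD//; last exact: key.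
apply: le_lt_trans (ler_normB _ _) _; rewrite ltrD//; last exact: key.
apply: le_lt_trans (ler_normD _ _) _; rewrite ltrD//; exact: key.
Qed.

End InnerProduct.

(** * Riesz representation and adjoints *)

Lemma complex_glb (R : realType) (A : set R[i]) (b : R[i]) : A !=set0 ->
  (forall x, A x -> b <= x) -> exists I : R[i],
    (forall x, A x -> I <= x) /\
    (forall s, 0 < s -> exists2 x, A x & x < I + s).
Proof.
move=> [x0 Ax0] Ab; have hinf : has_inf [set complex.Re x | x in A].
  split; first by exists (complex.Re x0), x0.
  by exists (complex.Re b) => _ [x /Ab + <-]; rewrite lecE => /andP[].
(* Comparable complex numbers have equal imaginary parts, so [b] fixes that of every element of
   [A]. *)
exists (inf [set complex.Re x | x in A] +i* complex.Im b)%C; split=> [x Ax|s].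
  rewrite lecE /=; have := Ab x Ax; rewrite lecE => /andP[-> _] /=.
  by apply: ge_inf; [exact: hinf.2|exists x].
case: s => s1 s2; rewrite ltcE /= => /andP[/eqP -> /inf_adherent].
move=> /(_ _ hinf) [_ [x Ax <-]] xs; exists x => //.
have := Ab x Ax; rewrite lecE => /andP[/eqP bx _].
by rewrite ltcE /= xs andbT addr0 bx.
Qed.

Section Riesz.
Context {C : numClosedFieldType} {H : completeNormedModType C}.
Variable (dot : {dot H for Num.conj}).
Hypothesis dot_norm : forall f, `|f| ^+ 2 = dot f f.
Hypothesis glb : forall (A : set C) (b : C), A !=set0 ->
  (forall x, A x -> b <= x) -> exists I : C,
    (forall x, A x -> I <= x) /\
    (forall s, 0 < s -> exists2 x, A x & x < I + s).

(* The representing vector minimizes the functional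
   [J f = |f|^2 - 2 Re (phi f)]; minimizing families are Cauchy by the
   parallelogram identity. *)
Lemma riesz_representation (phi : H -> C) (c : C) : scalar phi -> 0 <= c ->
  (forall f, `|phi f| <= c * `|f|) -> exists g, forall f, phi f = dot f g.
Proof.
move=> phi_lin c0 phi_le.
have phiDZ f h t : phi (f + t *: h) = phi f + t * phi h.
  by rewrite addrC phi_lin addrC.
have phi0 : phi 0 = 0.
  by have := phi_lin (-1) 0 0; rewrite scaler0 addr0 mulN1r addNr.
have phiZ t h : phi (t *: h) = t * phi h.
  by rewrite -[t *: h]add0r phiDZ phi0 add0r.
have phiD f h : phi (f + h) = phi f + phi h.
  by rewrite -{1}[h]scale1r phiDZ mul1r.
pose J f := dot f f - phi f - (phi f)^*.
have J_ge f : - c ^+ 2 <= J f.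
  have Re_le : phi f + (phi f)^* <= 2 * `|phi f|.
    rewrite mulr_natl mulr2n -{2}norm_conjC.
    apply: le_trans (ler_normD _ _); apply: real_ler_norm.
    by rewrite CrealE rmorphD /= conjCK addrC.
  rewrite /J -addrA -opprD -dot_norm.
  apply: le_trans (lerB (lexx _) Re_le).
  apply: (@le_trans _ _ (`|f| ^+ 2 - 2 * (c * `|f|))); last first.
    by rewrite lerB// ler_wpM2l.
  rewrite -subr_ge0.
  have -> : `|f| ^+ 2 - 2 * (c * `|f|) - - c ^+ 2 = (`|f| - c) ^+ 2 by ring.
  by rewrite real_exprn_even_ge0// rpredB// ger0_real.
have [I [I_le I_inf]] : exists I : C, (forall f, I <= J f) /\
    (forall s, 0 < s -> exists f, J f < I + s).
  have [] := @glb (range J) (- c ^+ 2).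
  - by exists (J 0), 0.
  - by move=> _ [f _ <-].
  - move=> I [I1 I2]; exists I; split=> [f|s /I2[_ [f _ <-]]]; last by exists f.
    by apply: I1; exists f.
have /choice[h hJ] s : exists f, 0 < s -> J f < I + s.
  by have [/I_inf[f fs]|_] := boolP (0 < s); [exists f | exists 0].
have para f g : dot (f - g) (f - g) =
    2 * J f + 2 * J g - 4 * J (2^-1 *: (f + g)).
  have half : (2^-1 : C)^* = 2^-1 by rewrite geC0_conj// invr_ge0.
  rewrite /J phiZ phiD rmorphM rmorphD /= dotZl dotZr half.
  by rewrite dotBl !dotBr dotDl !dotDr; field.
have JD f u t : J (u + t *: f) =
    J u + t * (dot f u - phi f) + (t * (dot f u - phi f))^* + t * t^* * dot f f.
  rewrite /J phiDZ dotDl !dotDr !dotZl !dotZr (dotC dot u f).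
  by rewrite !(rmorphD, rmorphB, rmorphM) /=; ring.
have [g hg] : exists g : H, h @ 0^'+ --> g.
  apply: dot_cauchy_cvg => // e e0.
  have e4 : 0 < e / 4 by rewrite divr_gt0.
  exists [set s | 0 < s < e / 4]; first exact: near_right0.
  move=> s t /= /andP[s0 se] /andP[t0 te]; rewrite para.
  have -> : e = 2 * (I + e / 4) + 2 * (I + e / 4) - 4 * I by field.
  have J_lt r : 0 < r -> r < e / 4 -> 2 * J (h r) < 2 * (I + e / 4).
    move=> r0 re; rewrite ltr_pM2l//; apply: lt_trans (hJ r r0) _.
    by rewrite ltrD2l.
  by rewrite ltr_leB ?ltrD ?J_lt// ler_wpM2l.
exists g => f; apply/eqP; rewrite eq_sym -subr_eq0; apply/eqP.
pose w s := dot f (h s) - phi f.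
(* Near-minimality of [h s] is tested against a step along [f]; the [+ 1] in [m] keeps the step
   defined when [f = 0]. *)
have w_le s : 0 < s -> `|w s| ^+ 2 <= s * (dot f f + 1).
  move=> s0; set m := dot f f + 1.
  have m0 : 0 < m by rewrite ltr_wpDl.
  have := I_le (h s - (m^-1 * (w s)^*) *: f).
  rewrite -scaleNr JD.
  have -> : - (m^-1 * (w s)^*) * w s = - (m^-1 * `|w s| ^+ 2).
    by rewrite normCK; ring.
  have mr : m^-1 \is Num.real by rewrite ger0_real// invr_ge0 ltW.
  have -> : (- (m^-1 * `|w s| ^+ 2))^* = - (m^-1 * `|w s| ^+ 2).
    by apply/CrealP; rewrite rpredN rpredM ?rpredX ?normr_real.
  rewrite -normCK normrN normrM norm_conjC.
  rewrite (ger0_norm (_ : 0 <= m^-1)) ?invr_ge0 ?(ltW m0)//.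
  have -> : J (h s) - m^-1 * `|w s| ^+ 2 - m^-1 * `|w s| ^+ 2 +
     (m^-1 * `|w s|) ^+ 2 * dot f f =
      J (h s) - m^-1 * `|w s| ^+ 2 - (m^-1) ^+ 2 * `|w s| ^+ 2.
    have -> : dot f f = m - 1 by rewrite addrK.
    move: (J _) (`|w s|) (m) m0 => a b r r0.
    by field; rewrite gt_eqF.
  rewrite -addrA -opprD lerBrDr => I_le1.
  have := le_lt_trans I_le1 (hJ s s0); rewrite ltrD2l => ws.
  rewrite -ler_pdivrMr// mulrC; apply: le_trans (ltW ws).
  by rewrite lerDl mulr_ge0// ?exprn_ge0// invr_ge0 ltW.
have : w s @[s --> 0^'+] --> dot f g - phi f.
  by apply: cvgB; [exact: dotr_cvg|exact: cvg_cst].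
move=> /cvg_unique; apply => //.
apply/cvgrPdistC_lt => e e0.
have d0 : 0 < e ^+ 2 / (dot f f + 1) by rewrite divr_gt0 ?exprn_gt0 ?ltr_wpDl.
apply: filterS (near_right0 d0) => s /andP[s0 sd]; rewrite subr0.
rewrite -(@ltr_pXn2r _ 2) ?nnegrE ?(ltW e0)//.
apply: le_lt_trans (w_le s s0) _.
by rewrite -ltr_pdivlMr ?ltr_wpDl.
Qed.

(** Boundedness of [A] lets Riesz supply a candidate, so the default value of [adjoint] is never
    taken. *)
Lemma adjointE (A : {linear H -> H}) : continuous A ->
  forall f g, dot (A f) g = dot f (adjoint dot A g).
Proof.
move=> A_cont.
have [k k0 A_le] : exists2 k, 0 < k & forall f, `|A f| <= k * `|f|.
  have /linear_bounded_continuous/linear_boundedP := A_cont.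
  move=> /pinfty_ex_gt0[k k0 Ak].
  by exists k.
have /choice[B AB] g : exists u, forall f, dot (A f) g = dot f u.
  apply: (@riesz_representation _ (k * `|g|)) => [a f h||f].
  - by rewrite linearP dotDl dotZl.
  - by rewrite mulr_ge0// ltW.
  - by rewrite (le_trans (dot_le_norm dot_norm _ _))// mulrAC ler_wpM2r.
rewrite /adjoint; case: xgetP => [B' _ //|/(_ B)[]].
by move=> f g; rewrite AB.
Qed.

End Riesz.

(** * Functionals annihilating the ranges of a tuple *)

Section CommonAnnihilator.
Context {C : numClosedFieldType} {n : nat} {H : completeNormedModType C}.
Variables (dot : {dot H for Num.conj}) (T : 'I_n -> {linear H -> H}).
Hypothesis dot_norm : forall f, `|f| ^+ 2 = dot f f.

(** Membership in the joint kernel of the adjoints, put so that no adjoint has to exist. *)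
Definition annihilates (k : H) := forall j f, dot (T j f) k = 0.

(** A nonconstant monomial in [T] maps into the range of some [T j], so only the constant
    coefficient survives. *)
Lemma dot_poly_op (k : H) : annihilates k -> forall p f,
  dot (poly_op (fun j => T j : H -> H) p f) k = mp_eval p 0 * dot f k.
Proof.
move=> kT p f; rewrite /mp_eval mevalE /poly_op dot_suml mulr_suml.
apply: eq_bigr => mu _; rewrite -mulrA; congr (_ * _).
elim: (index_enum _) => [|i s IH]; first by rewrite !big_nil mul1r.
rewrite !big_cons /= mxE; case: (mu i) => [|d] /=; first by rewrite mul1r.
by rewrite kT exprS mul0r !mul0r.
Qed.

(** With [g] the preimage of [f] under [q(T)], the identity [dot f k = q(0) * dot g k] forces
    [dot g k = 0]. If [q(T)] is not invertible, [inv_op] is the zero map. *)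
Lemma dot_ratio_op (k : H) p q f : annihilates k -> mp_eval q 0 != 0 ->
  dot f k = 0 -> dot (ratio_op (fun j => T j : H -> H) p q f) k = 0.
Proof.
move=> kT q0 fk; rewrite /ratio_op /= dot_poly_op // /inv_op.
case: xgetP => [B _ [_ BK]|_]; last by rewrite linear0l mulr0.
apply/eqP; rewrite mulf_eq0; apply/orP; right.
move: fk; rewrite -{1}(BK f) dot_poly_op // => /eqP.
by rewrite mulf_eq0 (negPf q0).
Qed.

(* A common annihilator [k] of the ranges is not of the form
   [\sum_i +/- T_i f_i], so the Koszul complex is not exact in top degree. *)
Lemma taylor_spectrum0 (k : H) : annihilates k -> k != 0 ->
  taylor_spectrum (fun j => T j : H -> H) 0.
Proof.
move=> kT k0 S koszul_exact.
pose x : {ffun {set 'I_n} -> H} :=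
  [ffun J => if J == [set: 'I_n]%SET then k else 0].
have : [set x | koszul S x = 0] x.
  (* The coefficient at [J] reads [x] at [J :\ i], never at the full set, so the top-degree [k] is a
     cycle. *)
  apply/ffunP => J; rewrite !ffunE big1// => i iJ.
  rewrite /S ffunE ifF ?mxE ?scale0r ?linear0 ?oppr0 ?addr0 ?scaler0//.
  by apply/negbTE/eqP => /finset.setP/(_ i); rewrite !inE eqxx.
rewrite koszul_exact => -[y _ /ffunP/(_ [set: 'I_n]%SET)].
rewrite !ffunE eqxx => yk.
move: k0; rewrite -(dnorm_eq0 dot) -{1}yk dot_suml big1 ?eqxx// => i _.
by rewrite /S mxE scale0r subr0 kT mulr0.
Qed.

Lemma closure_orthogonal (A : set H) (k : H) : closure A = setT ->
  (forall f, A f -> dot f k = 0) -> k = 0.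
Proof.
move=> A_dense Ak; apply/eqP.
rewrite -normr_le0 real_leNgt ?normr_real ?real0//.
apply/negP => k0; have : closure A k by rewrite A_dense.
move=> /(_ (ball k `|k|)) []; first exact: nbhsx_ballx.
move=> f [/Ak fk]; rewrite -ball_normE /= => kf.
have := dot_le_norm dot_norm (k - f) k; rewrite dotBl fk subr0 -dot_norm.
rewrite ger0_norm ?exprn_ge0// expr2 ler_pM2r// => kkf.
by have := lt_le_trans kf kkf; rewrite ltxx.
Qed.

(* Every rational expression [r(T)] multiplies the functionals [dot ^~ k],
   for [k] annihilating the ranges, by the scalar [r(0)]; a cyclic family of
   size [d] thus admits at most [d] independent such functionals. *)
Lemma not_finitely_rationally_cyclic :
  (forall d, exists k : 'I_d.+1 -> H, (forall i, annihilates (k i)) /\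
     (forall c : 'rV[C]_d.+1, \sum_i c 0 i *: k i = 0 -> c = 0)) ->
  ~ finitely_rationally_cyclic (fun j => T j : H -> H).
Proof.
move=> kT [_ [/finite_seqP[s ->] s_cyclic]].
have [k [kan kfree]] := kT (size s).
(* A matrix with more rows than columns has a row relation; it yields [l != 0] orthogonal to all of
   [s]. *)
pose A := \matrix_(i < (size s).+1, j < size s) dot (k i) (s`_j).
have /rowV0Pn[c /sub_kermxP cA c0] : kermx A != 0.
  by rewrite -mxrank_eq0 mxrank_ker -lt0n subn_gt0 ltnS rank_leq_col.
pose l := \sum_i c 0 i *: k i.
have l_an : annihilates l.
  by move=> j f; rewrite dot_sumr big1// => i _; rewrite kan mulr0.
have ls f : f \in s -> dot f l = 0.
  move=> fs; rewrite dotC dot_suml.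
  have fi : (index f s < size s)%N by rewrite index_mem.
  move/rowP/(_ (Ordinal fi)): cA; rewrite !mxE => cA.
  rewrite [X in X^*](_ : _ = 0) ?rmorph0// -[RHS]cA.
  by apply: eq_bigr => i _; rewrite mxE /= nth_index.
have l0 : l != 0 by apply: contra_neq c0 => /kfree.
case/eqP: (l0); apply: (closure_orthogonal s_cyclic) => _ [d [a [u [uV ->]]]].
rewrite dot_suml big1// => i _; have [p [q [h [qz /= hs ->]]]] := uV i.
rewrite dot_ratio_op ?mulr0//; last exact: ls.
(* 0 lies in the Taylor spectrum because [l] annihilates the ranges; hence [q] does not vanish at
   0. *)
exact/qz/(taylor_spectrum0 l_an).
Qed.

End CommonAnnihilator.

(** * Polynomials with nonnegative coefficients *)

Section PolynomialTuple.
Context {C : numClosedFieldType} {n : nat}.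
Implicit Types (p : mpoly n C) (v : 'I_n -> C) (u w : 'rV[C]_n).

Definition nonneg_coef p := forall mu, 0 <= mcoeff mu p.

(** Each monomial of [p] is nonconstant: one factor is at most [e], the others at most 1. *)
Lemma meval_small p v (e : C) : nonneg_coef p -> mcoeff (@mnm0 n) p = 0 ->
  0 <= e <= 1 -> (forall i, 0 <= v i <= e) ->
  0 <= meval v p <= e * \sum_(mu <- msupp p) mcoeff mu p.
Proof.
move=> p_ge0 p0 /andP[e0 e1] v_e; rewrite mevalE mulr_sumr.
have v0 i : 0 <= v i by case/andP: (v_e i).
have ve i : v i <= e by case/andP: (v_e i).
have v1 i : v i <= 1 by apply: le_trans e1.
rewrite sumr_ge0 /=; last first.
  by move=> mu _; rewrite mulr_ge0// prodr_ge0// => i _; rewrite exprn_ge0.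
rewrite big_seq [leRHS]big_seq; apply: ler_sum => mu mu_p.
rewrite mulrC ler_wpM2r//.
have [i mui] : exists i, (0 < mu i)%N.
  apply/existsP; rewrite -[X in is_true X]negbK; apply/negP => /existsPn mu0.
  have muE : mu = @mnm0 n.
    by apply/mnmP => i; rewrite mnm0E; apply/eqP; rewrite -leqn0 leqNgt.
  by move: mu_p; rewrite muE mcoeff_msupp p0 eqxx.
rewrite (bigD1 i)//= -[leRHS]mulr1; apply: ler_pM.
- by rewrite exprn_ge0.
- by rewrite prodr_ge0// => k _; rewrite exprn_ge0.
- by rewrite -(prednK mui) exprS -[leRHS]mulr1 ler_pM// ?exprn_ge0// exprn_ile1.
- by rewrite prodr_ile1// => k _; rewrite exprn_ge0//= exprn_ile1.
Qed.

Lemma mp_eval_diamond p u w : mp_eval p (diamond u (conjv w)) =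
  \sum_(mu <- msupp p) mcoeff mu p *
     ((\prod_i u 0 i ^+ mu i) * (\prod_i w 0 i ^+ mu i)^*).
Proof.
rewrite /mp_eval mevalE; apply: eq_bigr => mu _; congr (_ * _).
rewrite rmorph_prod -big_split; apply: eq_bigr => i _ /=.
by rewrite !mxE exprMn rmorphXn.
Qed.

(* AM-GM: [2 |a b| <= |a|^2 + |b|^2] for each pair of monomials. *)
Lemma mp_eval_diamond_lt1 p u w : nonneg_coef p ->
  mp_eval p (diamond u (conjv u)) < 1 -> mp_eval p (diamond w (conjv w)) < 1 ->
  `|mp_eval p (diamond u (conjv w))| < 1.
Proof.
move=> p_ge0 u1 w1; rewrite -(ltr_pM2l (ltr0n C 2)) mulr1.
apply: le_lt_trans (ltrD u1 w1); rewrite !mp_eval_diamond -big_split /=.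
apply: le_trans (ler_wpM2l (ler0n C 2) (ler_norm_sum _ _ _)) _.
rewrite mulr_sumr; apply: ler_sum => mu _.
rewrite -mulrDr normrM normrM norm_conjC -!normCK (ger0_norm (p_ge0 mu)).
rewrite mulrCA ler_wpM2l// -subr_ge0.
set a := `|_|; set b := `|_|.
have -> : a ^+ 2 + b ^+ 2 - 2 * (a * b) = (a - b) ^+ 2 by ring.
by rewrite real_exprn_even_ge0// rpredB ?normr_real.
Qed.

Lemma positive_regular_mcoeff (P : 'I_n -> mpoly n C) : positive_regular P ->
  forall j, [/\ nonneg_coef (P j), mcoeff (@mnm0 n) (P j) = 0 &
    0 < mcoeff (mnm1 j) (P j)].
Proof.
move=> hP j; have [Pj_ge0 [a [N [Q [a0 Qhom PE]]]]] := hP j.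
have Q_coef (mu : multinom n) : (mdeg mu < 2)%N ->
    mcoeff mu (\sum_(2 <= k < N.+1) Q k) = 0.
  move=> mu2; rewrite raddf_sum big_nat big1 //= => k /andP[k2 _].
  by rewrite (dhomog_nemf_coeff (Qhom k))// neq_ltn (leq_trans mu2).
split=> //; rewrite PE mcoeffD mcoeffZ Q_coef ?addr0 ?mdeg0 ?mdeg1//.
- by rewrite mcoeffX mnm1_eq0 mulr0.
- by rewrite mcoeffX eqxx mulr1.
Qed.

Lemma positive_regular_radius (P : 'I_n -> mpoly n C) : positive_regular P ->
  exists2 e, 0 < e <= 1 & forall v, (forall i, 0 <= v i <= e) ->
    forall j, meval v (P j) < 1.
Proof.
(* The radius is the inverse of 1 plus the sum of all coefficients of all [P j], so that
   [meval_small] gives values below 1. *)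
move=> /positive_regular_mcoeff hP.
pose s j := \sum_(mu <- msupp (P j)) mcoeff mu (P j).
have s0 j : 0 <= s j by apply: sumr_ge0 => mu _; have [] := hP j.
have S0 : 0 <= \sum_j s j by apply: sumr_ge0.
have S1 : 0 < 1 + \sum_j s j by rewrite ltr_wpDr.
have e0 : 0 < (1 + \sum_j s j)^-1 by rewrite invr_gt0.
have e1 : (1 + \sum_j s j)^-1 <= 1 by rewrite invf_le1// lerDl.
exists (1 + \sum_j s j)^-1; first by rewrite e0.
move=> v v_e j; have [P0 Pc _] := hP j.
have e01 : 0 <= (1 + \sum_j s j)^-1 <= 1 by rewrite (ltW e0).
have /andP[_ le_e] := meval_small P0 Pc e01 v_e.
apply: le_lt_trans le_e _; rewrite mulrC ltr_pdivrMr// mul1r (bigD1 j)//=.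
by rewrite addrCA ltr_pwDr// ltr_wpDr ?sumr_ge0.
Qed.

(** Makes [p] along a polynomial curve a one-variable polynomial, whose limits come from
    [horner_cvg]. *)
Definition psubst (h : 'I_n -> {poly C}) p : {poly C} :=
  \sum_(mu <- msupp p) mcoeff mu p *: \prod_i h i ^+ mu i.

Lemma horner_psubst h p x : (psubst h p).[x] = meval (fun i => (h i).[x]) p.
Proof.
rewrite mevalE horner_sum; apply: eq_bigr => mu _.
rewrite hornerZ horner_prod; congr (_ * _).
by apply: eq_bigr => i _; rewrite horner_exp.
Qed.

Definition axis_poly (i0 : 'I_n) p := psubst (fun i => (i == i0)%:R *: 'X) p.

(** Every monomial contributes nonnegatively to the coefficient of ['X], and [mnm1 i0] contributes
    its own coefficient. *)
Lemma axis_poly_coef1 (i0 : 'I_n) p : nonneg_coef p ->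
  mcoeff (mnm1 i0) p <= (axis_poly i0 p)`_1.
Proof.
move=> p_ge0.
have coefE (mu : multinom n) :
    (\prod_i ((i == i0)%:R *: 'X : {poly C}) ^+ mu i)`_1 =
    (\prod_i (i == i0)%:R ^+ mu i) * (1 == \sum_i mu i)%N%:R.
  under eq_bigr do rewrite exprZn.
  by rewrite scaler_prod coefZ prodrXr coefXn.
rewrite /axis_poly /psubst coef_sum.
have term_ge0 mu :
    0 <= (mcoeff mu p *: \prod_i ((i == i0)%:R *: 'X : {poly C}) ^+ mu i)`_1.
  by rewrite coefZ coefE !mulr_ge0 ?prodr_ge0// => i _; rewrite exprn_ge0.
have [i0p|/memN_msupp_eq0 ->] := boolP (mnm1 i0 \in msupp p);
  last exact: sumr_ge0.
rewrite (bigD1_seq _ i0p) ?msupp_uniq//=.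
apply: le_trans (_ : _ <= (mcoeff (mnm1 i0) p *:
  \prod_i ((i == i0)%:R *: 'X : {poly C}) ^+ (mnm1 i0) i)`_1) _.
  rewrite coefZ coefE -mdegE mdeg1 eqxx mulr1 big1 ?mulr1// => i _.
  by rewrite mnm1E eq_sym; case: eqP => [_|]; rewrite ?expr1n ?expr0.
by rewrite lerDl sumr_ge0.
Qed.

End PolynomialTuple.

(** * One-variable polynomials *)

Lemma coef01_prod (C : comNzRingType) (I : Type) (s : seq I)
    (F : I -> {poly C}) : (forall i, (F i)`_0 = 1) ->
  (\prod_(i <- s) F i)`_0 = 1 /\
  (\prod_(i <- s) F i)`_1 = \sum_(i <- s) (F i)`_1.
Proof.
move=> F0; elim: s => [|i s [IH0 IH1]]; first by rewrite !big_nil !coef1.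
rewrite !big_cons !coefM !big_ord_recl !big_ord0 /= F0 IH0 IH1.
by rewrite !mul1r mulr1 !addr0 addrC.
Qed.

Lemma poly_eq0_near0 {C : numFieldType} (p : {poly C}) (e : C) : 0 < e ->
  (forall y, 0 < y <= e -> p.[y] = 0) -> p = 0.
Proof.
move=> e0 pe; pose f (k : nat) := e / k.+1%:R.
apply: (@roots_geq_poly_eq0 _ p [seq f k | k <- iota 0 (size p)]).
- apply/allP => _ /mapP[k _ ->]; apply/rootP/pe.
  rewrite /f divr_gt0 ?ltr0n//=.
  by rewrite ler_pdivrMr ?ltr0n// ler_peMr ?(ltW e0)// ler1n.
- rewrite map_inj_uniq ?iota_uniq// => k l fkl.
  have /invr_inj/eqP := mulfI (lt0r_neq0 e0) fkl.
  by rewrite eqr_nat => /eqP[].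
- by rewrite size_map size_iota.
Qed.

(* If [rho] is a root of [q], then [1 / q.[t y]] has a pole at [y = rho / t]
   which is not a pole of [1 / q.[t' y]] for [t'] much smaller than [t]. *)
Lemma inv_dilations_free {C : numClosedFieldType} (q : {poly C}) (e : C) d :
  q`_0 = 1 -> q`_1 != 0 -> 0 < e <= 1 ->
  (forall x, 0 <= x <= e -> q.[x] != 0) ->
  exists2 t : 'I_d -> C, (forall i, 0 < t i <= e) &
  forall c : 'rV[C]_d,
    (forall y, 0 < y <= e -> \sum_i c 0 i / q.[t i * y] = 0) -> c = 0.
Proof.
move=> q0 q1 /andP[e0 e1] qe.
have [rho rho_root] : exists rho, root q rho.
  apply/closed_rootP; apply: contra q1 => /eqP sq.
  by rewrite nth_default// sq.
have [tau /andP[tau0 tau1] qtau] : exists2 tau : C, 0 < tau < 1 &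
    forall y, 0 < y <= tau -> q.[rho * y] != 0.
  have : (q \Po (rho *: 'X)).[y] @[y --> (0 : C)^'+] --> (1 : C).
    rewrite (_ : 1 = (q \Po (rho *: 'X)).[0]); last first.
      by rewrite horner_comp !hornerE horner_coef0 q0.
    exact: horner_cvg id_cvg_right0.
  move=> /cvgrPdist_lt/(_ 1 ltr01)/nbhs_ballP[r /= r0 qr].
  (* This is smaller than both [r] and 1. *)
  exists (r / (2 * (r + 1))).
    rewrite divr_gt0 ?mulr_gt0 ?addr_gt0//= ltr_pdivrMr ?mulr_gt0 ?addr_gt0//.
    have -> : 1 * (2 * (r + 1)) = r + (r + 2) by ring.
    by rewrite ltrDl addr_gt0.
  move=> y /andP[y0 yr]; have /qr/(_ y0) : ball_ Num.norm 0 r y.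
    rewrite /= sub0r normrN gtr0_norm//; apply: le_lt_trans yr _.
    rewrite ltr_pdivrMr ?mulr_gt0 ?addr_gt0// ltr_pMr//.
    by rewrite mulrDr mulr1 ltr_wpDl ?ltr1n// mulr_ge0// ltW.
  rewrite horner_comp !hornerE; apply: contraTneq => ->.
  by rewrite subr0 normr1 ltxx.
have [[e0' tau0'] tau1'] := (ltW e0, ltW tau0, ltW tau1).
(* The dilations are geometric, so that ratios of later to earlier ones are powers of [tau], to
   which [qtau] applies. *)
exists (fun i => e * tau ^+ i) => [i|c cq].
  by rewrite mulr_gt0 ?exprn_gt0//= ler_piMr// exprn_ile1.
apply/eqP/negPn/negP => /rV0Pn[i1 ci1].
(* The least [i] with [c 0 i != 0] belongs to the largest dilation present. *)
case: (@arg_minnP _ i1 (fun i => c 0 i != 0) (fun i => i : nat) ci1).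
move=> i ci i_min.
pose qt (k : 'I_d) := q \Po ((e * tau ^+ k) *: 'X).
have qtE k y : (qt k).[y] = q.[e * tau ^+ k * y].
  by rewrite horner_comp !hornerE.
(* The relation with the denominators of index at least [i] cleared; earlier coefficients vanish. *)
pose W := \sum_j c 0 j *: \prod_(k < d | (k != j) && (i <= k)%N) qt k.
have W0 : W = 0.
  apply: (poly_eq0_near0 e0) => y y0e; rewrite horner_sum.
  transitivity (\prod_(k < d | (i <= k)%N) (qt k).[y] *
      \sum_j c 0 j / q.[e * tau ^+ j * y]); last by rewrite cq ?mulr0.
  rewrite mulr_sumr; apply: eq_bigr => j _; rewrite hornerZ horner_prod.
  have [->|cj0] := eqVneq (c 0 j) 0; first by rewrite !mul0r mulr0.
  rewrite [in RHS](bigD1 j) ?i_min//=.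
  rewrite qtE.
  set a := q.[_]; have a0 : a != 0.
    move: y0e => /andP[/ltW y0 ye].
    have et0 : 0 <= e * tau ^+ j by rewrite mulr_ge0 ?exprn_ge0.
    apply: qe; rewrite mulr_ge0//= -[leRHS]mul1r ler_pM//.
    by rewrite mulr_ile1 ?exprn_ge0 ?exprn_ile1.
  under eq_bigl do rewrite andbC.
  by field.
(* Only the summand [j = i] lacks the factor [qt i], which vanishes here. Its factors are the values
   of [q] at [rho * tau ^+ (k - i)] with [k > i], nonzero by [qtau]. *)
move/(congr1 (fun p : {poly C} => p.[rho / (e * tau ^+ i)])): W0.
rewrite horner0 horner_sum (bigD1 i)//= [X in _ + X]big1 ?addr0 => [|j ji];
  last first.
  rewrite hornerZ horner_prod (bigD1 i) ?leqnn ?andbT 1?eq_sym//=.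
  rewrite qtE [X in q.[X]](_ : _ = rho).
    by rewrite (rootP rho_root) mul0r mulr0.
  by field; rewrite expf_neq0 ?gt_eqF.
rewrite hornerZ horner_prod => /eqP; rewrite mulf_eq0 (negPf ci)/=.
move/prodf_eq0 => [k /andP[ki ik]].
apply/negP; rewrite qtE.
have -> : e * tau ^+ k * (rho / (e * tau ^+ i)) = rho * tau ^+ (k - i).
  by rewrite -{1}(subnKC ik) exprD; field; rewrite expf_neq0 ?gt_eqF.
apply: qtau; rewrite exprn_gt0//=.
have : (0 < k - i)%N by rewrite subn_gt0 ltn_neqAle ik andbT eq_sym.
by case: (k - i)%N => // d1 _; rewrite exprS ler_piMr ?exprn_ile1.
Qed.

(** * The kernel denominator on a coordinate axis *)

Section AxisDenominator.
Context {C : numClosedFieldType} {n : nat}.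
Variables (P : 'I_n -> mpoly n C) (m : 'I_n -> nat) (i0 : 'I_n).
Hypothesis P_reg : positive_regular P.

Definition axis_den : {poly C} := \prod_j (1 - axis_poly i0 (P j)) ^+ m j.

Lemma horner_axis_den x : axis_den.[x] =
  \prod_j (1 - meval (fun i => if i == i0 then x else 0) (P j)) ^+ m j.
Proof.
rewrite horner_prod; apply: eq_bigr => j _; rewrite !hornerE horner_psubst.
congr ((1 - _) ^+ _); apply: meval_eq => i.
by rewrite !hornerE; case: eqP => _; rewrite ?mul1r ?mul0r.
Qed.

Lemma axis_poly_coef0 j : (axis_poly i0 (P j))`_0 = 0.
Proof.
have [P_ge0 P0 _] := positive_regular_mcoeff P_reg j.
apply/le_anti; rewrite -horner_coef0 horner_psubst andbC.
pose v (i : 'I_n) : C := ((i == i0)%:R *: 'X).[0].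
(* Taking [e = 0] squeezes the value at the origin between 0 and 0. *)
have := @meval_small _ _ _ v 0 P_ge0 P0.
rewrite lexx ler01 mul0r; apply => // i.
by rewrite /v !hornerE lexx.
Qed.

Let factor_coef0 j : ((1 - axis_poly i0 (P j)) ^+ m j)`_0 = 1.
Proof.
rewrite -horner_coef0 !hornerE horner_coef0 axis_poly_coef0.
by rewrite subr0 expr1n.
Qed.

Lemma axis_den_coef0 : axis_den`_0 = 1.
Proof. by have [] := coef01_prod (index_enum 'I_n) factor_coef0. Qed.

(** The coefficient is minus the sum of [m j] times the linear coefficients of the [P j] on the
    axis. All terms are nonnegative, and that of [i0] is positive. *)
Lemma axis_den_coef1 : (0 < m i0)%N -> axis_den`_1 != 0.
Proof.
move=> m0; have [_ ->] := coef01_prod (index_enum 'I_n) factor_coef0.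
have coefE j : ((1 - axis_poly i0 (P j)) ^+ m j)`_1 =
    - ((axis_poly i0 (P j))`_1 *+ m j).
  rewrite -[m j in LHS]card_ord -prodr_const.
  have F0 (i : 'I_(m j)) : (1 - axis_poly i0 (P j))`_0 = 1.
    by rewrite coefB axis_poly_coef0 coef1 subr0.
  have [_ ->] := coef01_prod (index_enum 'I_(m j)) F0.
  by rewrite sumr_const card_ord coefB coef1 sub0r mulNrn.
under eq_bigr do rewrite coefE.
rewrite sumrN oppr_eq0 gt_eqF// (bigD1 i0)//= ltr_pwDl//.
  have [P_ge0 _ Pa] := positive_regular_mcoeff P_reg i0.
  by rewrite pmulrn_lgt0//; apply: lt_le_trans Pa (axis_poly_coef1 _ P_ge0).
apply: sumr_ge0 => j _; have [P_ge0 _ _] := positive_regular_mcoeff P_reg j.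
by rewrite mulrn_wge0//; apply: le_trans (axis_poly_coef1 _ P_ge0).
Qed.

End AxisDenominator.

(** * Limits of kernel functions of the triangle *)

Lemma cvg_right0_eq {C : numFieldType} {T : topologicalType} (f g : C -> T)
    (e : C) (l : T) : 0 < e -> (forall s, 0 < s <= e -> f s = g s) ->
  f @ 0^'+ --> l -> g @ 0^'+ --> l.
Proof.
move=> e0 fg; apply: cvg_trans; apply: near_eq_cvg.
by apply: filterS (near_right0 e0) => s /andP[s0 se]; rewrite fg// s0 ltW.
Qed.

Section Points.
Context {C : numClosedFieldType} {n : nat}.
Implicit Types (v : 'I_n -> C).

Definition phi_inv v : 'rV[C]_n := \row_(j < n) \prod_(k < n | (j <= k)%N) v k.

Lemma phi_phi_inv v : (forall k : 'I_n, (0 < k)%N -> v k != 0) ->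
  phi (phi_inv v) = \row_k v k.
Proof.
move=> v0; apply/rowP => j; rewrite !mxE.
case: insubP => [k _ kj|]; rewrite ?mxE.
  rewrite (bigD1 j)//= -mulrA.
  rewrite (eq_bigl (fun l : 'I_n => (k <= l)%N)); last first.
    by move=> l; rewrite kj ltn_neqAle andbC eq_sym.
  rewrite divff ?mulr1//; apply/prodf_neq0 => l kl.
  by apply: v0; apply: leq_trans kl; rewrite kj.
rewrite -leqNgt => jn; rewrite (bigD1 j)//= big1 ?mulr1// => l /andP[jl lj].
suff : l = j by move=> lje; rewrite lje eqxx in lj.
by apply/val_inj/eqP; rewrite eqn_leq jl andbT -ltnS (leq_trans (ltn_ord l)).
Qed.

End Points.

Section TriangleSpace.
Context {C : numClosedFieldType} {n' : nat}.
Local Notation n := n'.+2.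
Variables (P : 'I_n -> mpoly n C) (m : 'I_n -> nat).
Context {H : completeNormedModType C}.
Variables (dot : {dot H for Num.conj}) (ev : H -> 'rV[C]_n -> C).
Variable (M : 'I_n -> {linear H -> H}).
Hypothesis P_reg : positive_regular P.
Hypothesis m_gt0 : forall j, (0 < m j)%N.
Hypothesis H_rkhs : is_rkhs (triangle P) (triangle_kernel P m) dot ev.
Hypothesis M_mult : is_mult_tuple (triangle P) ev M.

Local Notation D := (triangle P).
Let dot_norm := rkhs_norm H_rkhs.

(** The coordinate z_(n-1). Fixing u_(n-1) while the other u_k shrink makes every z_j tend to 0,
    since each contains the factor u_n. *)
Definition penult : 'I_n := inord n'.

Lemma penult_neq_max : (ord_max == penult) = false.
Proof. by rewrite -val_eqE /= inordK// gtn_eqF. Qed.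

Lemma phi_penult (z : 'rV[C]_n) : phi z 0 penult = z 0 penult / z 0 ord_max.
Proof.
rewrite mxE; case: insubP => [k _ kE|]; last by rewrite inordK// ltnSn.
by congr (_ / z 0 _); apply/val_inj; rewrite kE /= inordK.
Qed.

Definition coord_prod (z : 'rV[C]_n) := \prod_(j < n | (0 < j)%N) z 0 j.

Definition kernel_den (u w : 'rV[C]_n) :=
  \prod_j (1 - mp_eval (P j) (diamond u (conjv w))) ^+ m j.

Lemma coord_prod_neq0 z : D z -> coord_prod z != 0.
Proof. by move=> [z0 _]; apply/prodf_neq0 => j j0; apply: z0. Qed.

Lemma ev_dot z : D z -> exists k, forall f, ev f z = dot f k.
Proof. by move=> /(rkhs_reproducing H_rkhs)[k _ kE]; exists k. Qed.

(** Rescaling by the conjugate of [coord_prod w] cancels a factor of the kernel function that blows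
    up as [phi w] approaches the axis. *)
Lemma kernel_rescaled w : D w -> exists k : H,
  (forall z, D z -> ev k z = (coord_prod z)^-1 / kernel_den (phi z) (phi w)) /\
  (forall f, dot f k = coord_prod w * ev f w).
Proof.
move=> Dw; have [k kK kE] := rkhs_reproducing H_rkhs Dw.
exists ((coord_prod w)^* *: k); split=> [z Dz|f]; last first.
  by rewrite dotZr conjCK kE.
have [kz kzE] := ev_dot Dz.
rewrite kzE dotZl -kzE kK// /triangle_kernel mulrA; congr (_ * _).
  rewrite /coord_prod rmorph_prod -big_split -prodfV /=.
  apply: eq_bigr => j j0; rewrite invfM mulrCA divff ?mulr1//.
  by rewrite conjC_eq0; case: Dw => + _; apply.
by rewrite -prodfV.
Qed.

Definition axis_row (x s : C) : 'rV[C]_n :=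
  \row_(k < n) (if k == penult then x else s).

(** Since [axis_row x s] is real for nonnegative [x] and [s], conjugation drops out and the
    denominator is a polynomial in [s]. *)
Definition den_poly (u : 'rV[C]_n) (x : C) : {poly C} :=
  \prod_j (1 - psubst (fun k =>
     if k == penult then (u 0 k * x)%:P else u 0 k *: 'X) (P j)) ^+ m j.

Lemma horner_den_poly u x s : 0 <= x -> 0 <= s ->
  (den_poly u x).[s] = kernel_den u (axis_row x s).
Proof.
move=> x0 s0; rewrite horner_prod; apply: eq_bigr => j _.
rewrite !hornerE horner_psubst; congr ((1 - _) ^+ _); apply: meval_eq => k.
by rewrite !mxE; case: eqP => _; rewrite !hornerE geC0_conj.
Qed.

Local Notation q := (axis_den P m penult).

Lemma horner_den_poly0 u x : (den_poly u x).[0] = q.[u 0 penult * x].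
Proof.
rewrite horner_axis_den horner_prod; apply: eq_bigr => j _.
rewrite !hornerE horner_psubst; congr ((1 - _) ^+ _); apply: meval_eq => k.
by case: eqP => [->|_]; rewrite !hornerE.
Qed.

Variable (e : C).
Hypothesis e01 : 0 < e <= 1.
Hypothesis P_lt1 : forall v, (forall i, 0 <= v i <= e) ->
  forall j, meval v (P j) < 1.

Let e_gt0 : 0 < e. Proof. by case/andP: e01. Qed.
Let e_le1 : e <= 1. Proof. by case/andP: e01. Qed.

Lemma axis_row_inside x s j : 0 <= x <= e -> 0 <= s <= e ->
  mp_eval (P j) (diamond (axis_row x s) (conjv (axis_row x s))) < 1.
Proof.
move=> xe se; apply: P_lt1 => i; rewrite !mxE.
have sq y : 0 <= y <= e -> 0 <= y * y^* <= e.
  move=> /andP[y0 ye]; rewrite geC0_conj// mulr_ge0//=.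
  by rewrite -[leRHS]mulr1 ler_pM// (le_trans ye).
by case: ifP => _; apply: sq.
Qed.

Definition axis_pt x s := phi_inv (axis_row x s 0).

Lemma phi_axis_pt x s : 0 < x -> 0 < s -> phi (axis_pt x s) = axis_row x s.
Proof.
move=> x0 s0; rewrite phi_phi_inv => [|k _].
  by apply/rowP => k; rewrite mxE.
by rewrite mxE; case: ifP => _; rewrite gt_eqF.
Qed.

Lemma axis_pt_triangle x s : 0 < x <= e -> 0 < s <= e -> D (axis_pt x s).
Proof.
move=> /andP[x0 xe] /andP[s0 se]; split=> j.
  move=> _; rewrite mxE; apply/prodf_neq0 => k _.
  by rewrite mxE; case: ifP => _; rewrite gt_eqF.
by rewrite phi_axis_pt//; apply: axis_row_inside; rewrite ?xe ?se ltW.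
Qed.

Lemma q_neq0 y : 0 <= y <= e -> q.[y] != 0.
Proof.
move=> ye; rewrite horner_axis_den; apply/prodf_neq0 => j _.
rewrite expf_neq0// subr_eq0 eq_sym lt_eqF// P_lt1// => i.
by case: ifP => //; rewrite lexx ltW.
Qed.

(** [axis_row x 0] is not the image of a triangle point, but it satisfies the same inequalities, so
    [mp_eval_diamond_lt1] still bounds the mixed values. *)
Lemma q_phi_neq0 z x : D z -> 0 <= x <= e -> q.[phi z 0 penult * x] != 0.
Proof.
move=> [_ Dz] xe; have /andP[x0 _] := xe.
rewrite -horner_den_poly0 horner_den_poly//; apply/prodf_neq0 => j _.
have [P_ge0 _ _] := positive_regular_mcoeff P_reg j.
have e00 : (0 : C) <= 0 <= e by rewrite lexx ltW.
have lt1 := mp_eval_diamond_lt1 P_ge0 (Dz j) (axis_row_inside j xe e00).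
rewrite expf_neq0// subr_eq0; apply: contraTneq lt1 => <-.
by rewrite normr1 ltxx.
Qed.

Lemma q0 : q.[0] = 1.
Proof. by rewrite horner_coef0 axis_den_coef0. Qed.

(* The limit, as [s] tends to 0, of the rescaled kernel functions at the points
   [axis_pt x s]. *)
Lemma axis_kernel x : 0 < x <= e -> exists k : H,
  [/\ forall z, D z -> ev k z = (coord_prod z)^-1 / q.[phi z 0 penult * x],
      annihilates dot M k &
      forall f, coord_prod (axis_pt x s) * ev f (axis_pt x s)
        @[s --> 0^'+] --> dot f k].
Proof.
move=> xe; have /andP[x0 xe'] := xe.
have /choice[h hE] s : exists k : H, 0 < s <= e ->
    (forall z, D z -> ev k z = (coord_prod z)^-1 / (den_poly (phi z) x).[s]) /\
    (forall f, dot f k = coord_prod (axis_pt x s) * ev f (axis_pt x s)).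
  have [se|_] := boolP (0 < s <= e); last by exists 0.
  have /andP[s0 _] := se.
  have [k [kE kdot]] := kernel_rescaled (axis_pt_triangle xe se).
  exists k => _; split=> // z Dz; rewrite kE// phi_axis_pt//.
  by rewrite horner_den_poly// ltW.
have [k hk] : exists k : H, h @ 0^'+ --> k.
  (* The denominator at two such points involves only [x * x] and [s * t], hence the row with [s]
     set to 1. *)
  apply: (@gram_cvg _ _ dot dot_norm h
    (fun y => (den_poly (axis_row x 1) x).[y]^-1)
    (q.[x * x])^-1 e) => //.
    move=> s t se te; have [[hs _] [_ ht]] := (hE s se, hE t te).
    have /andP[s0 _] := se; have /andP[t0 _] := te.
    have Dt := axis_pt_triangle xe te.
    rewrite ht hs// mulrA divff ?coord_prod_neq0// mul1r phi_axis_pt//.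
    congr (_^-1); rewrite !horner_prod; apply: eq_bigr => j _.
    rewrite !hornerE !horner_psubst; congr ((1 - _) ^+ _); apply: meval_eq => i.
    by rewrite !mxE; case: eqP => _; rewrite !hornerE// mulrC.
  have d0 : (den_poly (axis_row x 1) x).[0] = q.[x * x].
    by rewrite horner_den_poly0 mxE eqxx.
  apply: cvgV; last by rewrite -d0; exact: horner_cvg id_cvg_right0.
  apply: q_neq0; rewrite mulr_ge0 ?(ltW x0)//= -[leRHS]mulr1.
  by rewrite ler_pM ?(ltW x0)// (le_trans xe').
exists k; split.
- move=> z Dz; have [kz kzE] := ev_dot Dz.
  have lim1 : ev (h s) z @[s --> 0^'+] --> ev k z.
    rewrite kzE; under eq_fun do rewrite kzE.
    exact: dotl_cvg.
  have lim2 : ev (h s) z @[s --> 0^'+] -->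
      (coord_prod z)^-1 / q.[phi z 0 penult * x].
    apply: (@cvg_right0_eq _ _
      (fun s => (coord_prod z)^-1 / (den_poly (phi z) x).[s]) _ e) => //.
      by move=> s se; have [-> ] := hE s se.
    apply: cvgM; first exact: cvg_cst.
    rewrite -horner_den_poly0; apply: cvgV; last first.
      exact: horner_cvg id_cvg_right0.
    by rewrite horner_den_poly0 q_phi_neq0// xe' ltW.
  exact: cvg_unique lim1 lim2.
- move=> j f.
  have lim1 : dot (M j f) (h s) @[s --> 0^'+] --> dot (M j f) k.
    exact: dotr_cvg.
  (* [w] is z_j at [axis_pt x s] as a polynomial in [s]; the factor u_n = s makes [w.[0] = 0]. *)
  pose w : {poly C} :=
    \prod_(i < n | (j <= i)%N) (if i == penult then x%:P else 'X).
  have lim2 : dot (M j f) (h s) @[s --> 0^'+] --> 0 * dot f k.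
    apply: (@cvg_right0_eq _ _ (fun s => w.[s] * dot f (h s)) _ e) => //.
      move=> s se; have [_ hs] := hE s se.
      rewrite !hs (M_mult j).2; last exact: axis_pt_triangle.
      rewrite [RHS]mulrCA; congr (_ * _).
      rewrite horner_prod mxE; apply: eq_bigr => i _.
      by rewrite mxE; case: ifP => _; rewrite !hornerE.
    apply: cvgM; last exact: dotr_cvg.
    have w0 : w.[0] = 0.
      rewrite horner_prod (bigD1 ord_max) ?leq_ord//=.
      by rewrite penult_neq_max hornerX mul0r.
    have wl := horner_cvg (p := w) (@id_cvg_right0 C).
    by rewrite w0 in wl; exact: wl.
  by rewrite -[RHS](mul0r (dot f k)); exact: cvg_unique lim1 lim2.
- move=> f; apply: (@cvg_right0_eq _ _ (fun s => dot f (h s)) _ e) => //.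
    by move=> s se; have [_ ->] := hE s se.
  exact: dotr_cvg.
Qed.

(** For the Gram entries, the rescaled values of [k y] at [axis_pt x s] are constant in [s]. *)
Lemma axis_kernels : exists k : C -> H, forall x, 0 < x <= e ->
  [/\ forall z, D z -> ev (k x) z = (coord_prod z)^-1 / q.[phi z 0 penult * x],
      annihilates dot M (k x) &
      forall y, 0 < y <= e -> dot (k y) (k x) = (q.[x * y])^-1].
Proof.
have /choice[k kE] x : exists k : H, 0 < x <= e ->
  [/\ forall z, D z -> ev k z = (coord_prod z)^-1 / q.[phi z 0 penult * x],
      annihilates dot M k &
      forall f, coord_prod (axis_pt x s) * ev f (axis_pt x s)
        @[s --> 0^'+] --> dot f k].
  by have [/axis_kernel[k kE]|_] := boolP (0 < x <= e); [exists k | exists 0].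
exists k => x xe; have [kx ann_kx lim_kx] := kE x xe; split=> // y ye.
have [ky _ _] := kE y ye; have /andP[x0 _] := xe.
apply: cvg_unique (lim_kx (k y)) _ => //.
apply: (@cvg_right0_eq _ _ (fun=> (q.[x * y])^-1) _ e) => //;
  last exact: cvg_cst.
move=> s se; have /andP[s0 _] := se; have Ds := axis_pt_triangle xe se.
by rewrite ky// mulrA divff ?coord_prod_neq0// mul1r phi_axis_pt// mxE eqxx.
Qed.

Lemma mul_cvg_right0 (a : C) : a * x @[x --> 0^'+] --> (0 : C).
Proof.
have : a * x @[x --> 0^'+] --> a * 0.
  by apply: cvgM; [exact: cvg_cst|exact: id_cvg_right0].
by rewrite mulr0.
Qed.

Lemma q_cvg1 (a : C) : (q.[a * x])^-1 @[x --> 0^'+] --> (1 : C).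
Proof.
rewrite -invr1 -q0; apply: cvgV; first by rewrite q0 oner_neq0.
exact/horner_cvg/mul_cvg_right0.
Qed.

(* The constant [1] divided by [z_2 ... z_n] belongs to the space, and so does
   the coordinate [u = z_(n-1) / z_n] divided by [z_2 ... z_n], the latter as
   the derivative at 0 of the family [k_x] (up to the factor [- q'(0)]). *)
Lemma low_degree_vectors : exists (f0 f1 : H) (c : C),
  [/\ c != 0, annihilates dot M f0,
      forall z, D z -> ev f0 z = (coord_prod z)^-1 &
      forall z, D z -> ev f1 z = c * (phi z 0 penult / coord_prod z)].
Proof.
have [k kE] := axis_kernels.
have small y x : 0 < y <= e -> 0 < x <= e -> 0 < y * x <= e.
  move=> /andP[y0 ye] /andP[x0 xe]; rewrite mulr_gt0//= -[leRHS]mulr1.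
  by rewrite ler_pM ?(ltW y0) ?(ltW x0)// (le_trans xe).
have [f0 hf0] : exists f0 : H, k @ 0^'+ --> f0.
  apply: (@gram_cvg _ _ dot dot_norm k (fun y => (q.[y])^-1) 1 e) => //.
    by move=> s t se te; have [_ _ ->] := kE t te; rewrite // mulrC.
  by have := q_cvg1 1; under eq_fun do rewrite mul1r.
have f0E z : D z -> ev f0 z = (coord_prod z)^-1.
  move=> Dz; have [kz kzE] := ev_dot Dz.
  have lim1 : dot (k x) kz @[x --> 0^'+] --> dot f0 kz by exact: dotl_cvg.
  rewrite kzE; apply: cvg_unique lim1 _ => //.
  apply: (@cvg_right0_eq _ _
    (fun x => (coord_prod z)^-1 * (q.[phi z 0 penult * x])^-1) _ e) => //.
    by move=> x xe; have [kx _ _] := kE x xe; rewrite -kzE kx.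
  by rewrite -[X in _ --> X]mulr1; apply: cvgM; [exact: cvg_cst|exact: q_cvg1].
have f0_ann : annihilates dot M f0.
  move=> j f.
  have lim1 : dot (M j f) (k x) @[x --> 0^'+] --> dot (M j f) f0.
    exact: dotr_cvg.
  apply: cvg_unique lim1 _ => //.
  apply: (@cvg_right0_eq _ _ (fun=> 0 : C) _ e) => //; last exact: cvg_cst.
  by move=> x xe; have [_ -> _] := kE x xe.
have kf0 y : 0 < y <= e -> dot (k y) f0 = 1.
  move=> ye.
  have lim1 : dot (k y) (k x) @[x --> 0^'+] --> dot (k y) f0 by exact: dotr_cvg.
  apply: cvg_unique lim1 _ => //.
  apply: (@cvg_right0_eq _ _ (fun x => (q.[y * x])^-1) _ e) => //;
    last exact: q_cvg1.
  by move=> x xe; have [_ _ ->] := kE x xe; rewrite // mulrC.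
have f0k y : 0 < y <= e -> dot f0 (k y) = 1.
  by move=> ye; rewrite dotC kf0// rmorph1.
have f0f0 : dot f0 f0 = 1.
  have lim1 : dot (k x) f0 @[x --> 0^'+] --> dot f0 f0 by exact: dotl_cvg.
  apply: cvg_unique lim1 _ => //.
  apply: (@cvg_right0_eq _ _ (fun=> 1 : C) _ e) => //; last exact: cvg_cst.
  by move=> x xe; rewrite kf0.
(* [r.[0]] is the derivative of [q] at 0. *)
have [r qr] : exists r : {poly C}, q = 1 + r * 'X.
  have /factor_theorem[r rE] : root (q - 1) 0.
    by apply/rootP; rewrite !hornerE q0 subrr.
  by exists r; rewrite -['X]subr0 -rE addrC subrK.
have r0 : r.[0] != 0.
  have := axis_den_coef1 P_reg (m_gt0 penult).
  by rewrite qr coefD coefMX coef1 add0r horner_coef0.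
have slope x : q.[x] != 0 -> (q.[x])^-1 - 1 = x * (- r.[x] / q.[x]).
  move=> qx; apply: (mulIf qx); rewrite mulrBl mulVf// mul1r -mulrA divfK//.
  by rewrite qr !hornerE; ring.
have slope_cvg (a : C) :
    - r.[a * x] / q.[a * x] @[x --> 0^'+] --> - r.[0] * 1.
  apply: cvgM; last exact: q_cvg1.
  by apply: cvgN; exact/horner_cvg/mul_cvg_right0.
(* Difference quotients at 0; their Gram entries are [- r.[s * t] / q.[s * t]], again functions of
   the product. *)
pose h x := x^-1 *: (k x - f0).
have [f1 hf1] : exists f1 : H, h @ 0^'+ --> f1.
  apply: (@gram_cvg _ _ dot dot_norm h
    (fun y => - r.[1 * y] / q.[1 * y]) (- r.[0] * 1) e) => //.
  move=> s t se te; have /andP[s0 _] := se; have /andP[t0 _] := te.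
  rewrite dotZl dotZr dotBl !dotBr f0f0 kf0// f0k//.
  have [_ _ ->] := kE t te; rewrite // mul1r geC0_conj ?invr_ge0 ?ltW//.
  have qst : q.[s * t] != 0.
    by have /andP[st ste] := small _ _ se te; apply: q_neq0; rewrite (ltW st).
  by rewrite [t * s]mulrC subrr subr0 slope//; field; rewrite qst !gt_eqF.
exists f0, f1, (- r.[0] * 1); split=> //; first by rewrite mulr1 oppr_eq0.
move=> z Dz; have [kz kzE] := ev_dot Dz.
have lim1 : dot (h x) kz @[x --> 0^'+] --> dot f1 kz by exact: dotl_cvg.
rewrite kzE; apply: cvg_unique lim1 _ => //.
pose u := phi z 0 penult.
apply: (@cvg_right0_eq _ _
  (fun x => - r.[u * x] / q.[u * x] * (u / coord_prod z)) _ e) => //.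
  move=> x xe; have /andP[x0 xe'] := xe; have [kx _ _] := kE x xe.
  rewrite dotZl dotBl -!kzE kx// f0E// -/u.
  rewrite -[X in _ - X]mulr1 -mulrBr.
  have qux : q.[u * x] != 0 by apply: q_phi_neq0 => //; rewrite (ltW x0).
  by rewrite slope//; field; rewrite qux coord_prod_neq0// gt_eqF.
by apply: cvgM; [exact: slope_cvg|exact: cvg_cst].
Qed.

(** * The two negative results *)

Lemma triangle_not_finitely_cyclic :
  ~ finitely_rationally_cyclic (fun j => M j : H -> H).
Proof.
apply: (not_finitely_rationally_cyclic dot_norm) => d.
have [t te t_free] := inv_dilations_free d.+1 (axis_den_coef0 _ _ P_reg)
  (axis_den_coef1 P_reg (m_gt0 penult)) e01 q_neq0.
have [k kE] := axis_kernels.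
exists (fun i => k (t i)); split=> [i|c ck]; first by have [] := kE _ (te i).
(* Evaluation at [axis_pt y e], where u_(n-1) is [y], turns a relation among the [k (t i)] into one
   among the inverses of [q.[t i * y]]. *)
apply: t_free => y ye.
have ee : 0 < e <= e by rewrite e_gt0 lexx.
have Dz := axis_pt_triangle ye ee; have [kz kzE] := ev_dot Dz.
have /andP[y0 _] := ye.
have : dot (\sum_i c 0 i *: k (t i)) kz = 0 by rewrite ck linear0l.
rewrite dot_suml => sum0.
apply: (mulfI (invr_neq0 (coord_prod_neq0 Dz))); rewrite mulr0.
rewrite -[RHS]sum0 mulr_sumr.
apply: eq_bigr => i _; rewrite -kzE; have [-> // _ _] := kE _ (te i).
by rewrite phi_axis_pt// mxE eqxx mulrCA [y * _]mulrC.
Qed.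

Lemma triangle_not_doubly_commuting :
  (forall j f g, dot (M j f) g = dot f (adjoint dot (M j) g)) ->
  ~ doubly_commuting dot (fun j => M j : H -> H).
Proof.
move=> adjE [_ /(_ ord_max penult)]; rewrite penult_neq_max => /(_ isT) comm.
have [f0 [f1 [c [c0 ann f0E f1E]]]] := low_degree_vectors.
have adj_f0 : adjoint dot (M ord_max) f0 = 0.
  by apply: (dot_eq0 (dot := dot)) => g; rewrite -adjE ann.
have M_f1 : M ord_max f1 = c *: M penult f0.
  apply/eqP; rewrite -subr_eq0; apply/eqP/(rkhs_inj H_rkhs) => z Dz.
  have [kz kzE] := ev_dot Dz.
  rewrite kzE dotBl dotZl -!kzE !(M_mult _).2// f0E// f1E// phi_penult.
  field; rewrite coord_prod_neq0//; case: Dz => z0 _; exact: z0.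
(* [c] times the squared norm of [M penult f0] is the product of [f1] with the adjoint of
   [M ord_max] applied to [M penult f0]; commutation moves that adjoint onto [f0]. *)
have Mf0 : M penult f0 = 0.
  apply/eqP; rewrite -(dnorm_eq0 dot).
  have := adjE ord_max f1 (M penult f0); rewrite M_f1 dotZl.
  have /= -> := congr1 (@^~ f0) comm.
  rewrite adj_f0 linear0 linear0r => /eqP.
  by rewrite mulf_eq0 (negPf c0).
(* For [n = 2] the coordinate z_(n-1) may vanish on the triangle, so a point with all coordinates
   nonzero is taken. *)
have ee : 0 < e <= e by rewrite e_gt0 lexx.
have Dz := axis_pt_triangle ee ee; have [kz kzE] := ev_dot Dz.
have : ev (M penult f0) (axis_pt e e) = 0 by rewrite Mf0 kzE linear0l.
rewrite (M_mult _).2// f0E// => /eqP; rewrite mulf_eq0 invr_eq0.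
rewrite (negPf (coord_prod_neq0 Dz)) orbF mxE; apply/negP/prodf_neq0 => i _.
by rewrite mxE; case: ifP => _; rewrite gt_eqF.
Qed.

End TriangleSpace.

Theorem proposition5p1 (R : realType) (n : nat) (hn : (2 <= n)%N)
  (P : 'I_n -> mpoly n R[i]) (hP : positive_regular P)
  (m : 'I_n -> nat) (hm : forall j, (0 < m j)%N)
  (H : completeNormedModType R[i]) (dot : {dot H for Num.conj})
  (ev : H -> 'rV[R[i]]_n -> R[i]) (hH : is_triangle_space P m dot ev)
  (M : 'I_n -> {linear H -> H}) (hM : is_mult_tuple (triangle P) ev M) :
  ~ doubly_commuting dot (fun j => M j : H -> H) /\
  ~ finitely_rationally_cyclic (fun j => M j : H -> H).
Proof.
case: n hn P hP m hm ev hH M hM => [//|[//|n]] _ P hP m hm ev [hH _] M hM.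
have [e e01 P_lt1] := positive_regular_radius hP.
split; last exact: (triangle_not_finitely_cyclic hP hm hH hM e01 P_lt1).
apply: (triangle_not_doubly_commuting hP hm hH hM e01 P_lt1) => j.
exact: (adjointE (rkhs_norm hH) (@complex_glb R) (hM j).1).
Qed.
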